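(* Let $N\ge 1$ be an integer, $h=1/N$, let $\beta_x,\beta_y\in\mathbb{R}$ be constants, $\|\beta\|_\infty=\max\{|\beta_x|,|\beta_y|\}$, and let $C>0$ be a constant for which the discrete Poincaré inequality $\|u\|_h\le C\|u\|_{\nabla,h}$ holds for all $u\in D_{0,h}$. Let $\epsilon\in\mathbb{R}$ satisfy $\epsilon>2C\|\beta\|_\infty$, and let $$b(u,v)=(\beta_x\nabla_{x+}u+\beta_y\nabla_{y+}u,\,v)_h+\epsilon\,(u,v)_{\nabla,h},\qquad u,v\in D_{0,h}.$$ Then there exists $\alpha>0$ such that $$b(u,u)\ge\alpha\,\|u\|_{\nabla,h}^2\qquad\text{for all }u\in D_{0,h}.$$
   Context: Let $N\ge1$ be an integer and $h=1/N$. The grid is $\Omega_h=\{(ih,jh):0\le i,j\le N\}\subset[0,1]^2$. $D_h$ is the real vector space of functions $u:\Omega_h\to\mathbb{R}$, with the notation $u_{i,j}=u(ih,jh)$, and $D_{0,h}\subset D_h$ is the subspace of functions vanishing at all boundary grid points (those with $i\in\{0,N\}$ or $j\in\{0,N\}$). The discrete inner product is $(u,v)_h=h^2\sum_{p\in\Omega_h}u(p)v(p)$, with $\|u\|_h^2=(u,u)_h$. The forward differences are $\nabla_{x+}u_{i,j}=(u_{i+1,j}-u_{i,j})/h$ and $\nabla_{y+}u_{i,j}=(u_{i,j+1}-u_{i,j})/h$. For $u\in D_{0,h}$, $u$ is extended by zero outside the grid, so that these differences are defined on all of $\Omega_h$. For $u,v\in D_{0,h}$, $(u,v)_{\nabla,h}=(\nabla_{x+}u,\nabla_{x+}v)_h+(\nabla_{y+}u,\nabla_{y+}v)_h$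 and $\|u\|_{\nabla,h}^2=(u,u)_{\nabla,h}$. *)

(* Defs.v *)
From HB Require Import structures.
From mathcomp Require Import all_boot all_order all_algebra.
From mathcomp Require Import reals.

Set Implicit Arguments.
Unset Strict Implicit.
Unset Printing Implicit Defensive.

Import Order.TTheory GRing.Theory Num.Theory.
Local Open Scope ring_scope.

Definition mesh (R : realType) (N : nat) : R := N%:R^-1.

(* The grid point (ih, jh) is encoded by its pair of indices (i, j). *)
Definition grid (N : nat) : finType := ('I_N.+1 * 'I_N.+1)%type.

Notation gridfun R N := {ffun grid N -> R}.

Definition boundary (N : nat) (p : grid N) : bool :=
  [|| p.1 == 0%N :> nat, p.1 == N :> nat, p.2 == 0%N :> nat | p.2 == N :> nat].

Definition gridfun0 (R : realType) (N : nat) : {pred gridfun R N} :=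
  fun u => [forall p, boundary p ==> (u p == 0)].

Arguments gridfun0 : clear implicits.

(* u_{i,j}, extended by zero to the indices outside the grid. Only indices
   past the upper end (i = N+1 or j = N+1) are needed below. *)
Definition ext0 (R : realType) (N : nat) (u : gridfun R N) (i j : nat) : R :=
  if (i <= N)%N && (j <= N)%N then u (inord i, inord j) else 0.

Definition dxp (R : realType) (N : nat) (u : gridfun R N) : gridfun R N :=
  [ffun p : grid N => (ext0 u p.1.+1 p.2 - ext0 u p.1 p.2) / mesh R N].

Definition dyp (R : realType) (N : nat) (u : gridfun R N) : gridfun R N :=
  [ffun p : grid N => (ext0 u p.1 p.2.+1 - ext0 u p.1 p.2) / mesh R N].

Definition ip (R : realType) (N : nat) (u v : gridfun R N) : R :=
  mesh R N ^+ 2 * \sum_(p : grid N) u p * v p.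

Definition norm_h (R : realType) (N : nat) (u : gridfun R N) : R :=
  Num.sqrt (ip u u).

Definition ip_grad (R : realType) (N : nat) (u v : gridfun R N) : R :=
  ip (dxp u) (dxp v) + ip (dyp u) (dyp v).

Definition norm_grad (R : realType) (N : nat) (u : gridfun R N) : R :=
  Num.sqrt (ip_grad u u).

Definition bform (R : realType) (N : nat) (betax betay eps : R)
    (u v : gridfun R N) : R :=
  ip [ffun p => betax * dxp u p + betay * dyp u p] v + eps * ip_grad u v.

(* Main.v *)
(** By Young's inequality with weight [C], [2 C |(d, u)_h| <= C^2 (d, d)_h + (u, u)_h]
    for each of the two difference quotients [d]. Adding them and using
    [(u, u)_h <= C^2 ||u||^2_{nabla,h}], the convection term is at least
    [- 3/2 C ||beta|| ||u||^2_{nabla,h}], so [alpha = eps - 2 C ||beta||] works. *)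

Require Import Defs.
From mathcomp Require Import all_boot all_order all_algebra.
From mathcomp Require Import reals.
From mathcomp Require Import ring lra.

Import Order.TTheory GRing.Theory Num.Theory.
Local Open Scope ring_scope.

Lemma ip_ge0 {R : realType} {N : nat} (u : gridfun R N) : 0 <= ip u u.
Proof.
apply: mulr_ge0; first exact: sqr_ge0.
by apply: sumr_ge0 => p _; rewrite -expr2 sqr_ge0.
Qed.

Lemma ip_grad_ge0 {R : realType} {N : nat} (u : gridfun R N) :
  0 <= ip_grad u u.
Proof. by apply: addr_ge0; apply: ip_ge0. Qed.

Lemma ip_linear_combl {R : realType} {N : nat} (a b : R) (u v w : gridfun R N) :
  ip [ffun p => a * u p + b * v p] w = a * ip u w + b * ip v w.
Proof.
rewrite /ip !mulr_sumr -big_split /=.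
by apply: eq_bigr => p _; rewrite ffunE; ring.
Qed.

Lemma ipC {R : realType} {N : nat} (u v : gridfun R N) : ip u v = ip v u.
Proof. by rewrite /ip; congr (_ * _); apply: eq_bigr => p _; rewrite mulrC. Qed.

(** Expand the nonnegative squared norm of [c * u + s * v]: the choices [s = 1] and [s = -1] bound
    [ip u v] from both sides. *)
Lemma ip_young {R : realType} {N : nat} (c : R) (u v : gridfun R N) :
  0 <= c -> 2 * c * `|ip u v| <= c ^+ 2 * ip u u + ip v v.
Proof.
move=> c0.
have sq (s : R) : 0 <= c ^+ 2 * ip u u + 2 * c * s * ip u v + s ^+ 2 * ip v v.
  have := ip_ge0 [ffun p => c * u p + s * v p].
  rewrite ip_linear_combl (ipC u) (ipC v) !ip_linear_combl (ipC v u).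
  by move/le_trans; apply; rewrite le_eqVlt; apply/orP; left; apply/eqP; ring.
have := sq 1; have := sq (-1).
by case: (ger0P (ip u v)) => _ ? ?; lra.
Qed.

Theorem lemma5 (R : realType) (N : nat) (hN : (1 <= N)%N)
    (betax betay C eps : R) (hC : 0 < C)
    (poincare : forall u : gridfun R N, u \in gridfun0 R N ->
       norm_h u <= C * norm_grad u)
    (heps : 2 * C * Num.max `|betax| `|betay| < eps) :
  exists alpha : R, 0 < alpha /\
    forall u : gridfun R N, u \in gridfun0 R N ->
      alpha * norm_grad u ^+ 2 <= bform betax betay eps u u.
Proof.
set B := Num.max _ _ in heps.
exists (eps - 2 * C * B); split; first by rewrite subr_gt0.
move=> u u0.
have B0 : 0 <= B by rewrite le_max normr_ge0.
have G0 := ip_grad_ge0 u.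
(* The hypothesis compares square roots; both sides are nonnegative, so it can be squared. *)
have poincare_sq : ip u u <= C ^+ 2 * ip_grad u u.
  rewrite -(sqr_sqrtr (ip_ge0 u)) -(sqr_sqrtr G0) -exprMn.
  by rewrite lerXn2r ?nnegrE ?mulr_ge0 ?sqrtr_ge0 ?(ltW hC) //; exact: poincare.
rewrite /norm_grad sqr_sqrtr // /bform ip_linear_combl.
(* Stated with the factor [2 * C], to use Young's inequality without dividing; the goal is scaled by
   the same factor at the end. *)
have conv (b : R) (d : gridfun R N) : `|b| <= B ->
    - (B * (C ^+ 2 * ip d d + ip u u)) <= 2 * C * (b * ip d u).
  move=> bB; have C2 : 0 <= 2 * C by lra.
  have young := ip_young C d u (ltW hC).
  have : 2 * C * `|b * ip d u| <= B * (C ^+ 2 * ip d d + ip u u).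
    by rewrite normrM mulrCA; apply: ler_pM => //; apply: mulr_ge0.
  have := ler_wpM2l C2 (lerNnormlW (lexx `|b * ip d u|)).
  by lra.
have Bx : `|betax| <= B by rewrite le_max lexx.
have By : `|betay| <= B by rewrite le_max lexx orbT.
have convx := conv _ (dxp u) Bx.
have convy := conv _ (dyp u) By.
have BP := ler_wpM2l B0 poincare_sq.
(* After scaling by [2 * C], this [alpha] leaves room for a loss of four times this quantity. Adding
   [convx], [convy] and twice [BP] costs only three, and the sign of the fourth closes the gap. *)
have BCG : 0 <= B * (C ^+ 2 * ip_grad u u).
  by rewrite !mulr_ge0 // ltW.
rewrite -(ler_pM2l (mulr_gt0 (ltr0Sn R 1) hC)).
move: BP BCG convx convy; rewrite /ip_grad.
by lra.
Qed.
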